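(* Let $F$ be a Markov chain on a measurable space $S$ and $p:S\to\{1,\dots,d\}$ a measurable priority function. If there exists a progress-measure supermartingale for $(F,p)$, then $\mathbb{P}_{x_0}[\mathbf{Parity}(p)]=1$ for every $x_0\in S$.
   Context: A Markov chain on a measurable space $S$ is a Markov kernel $F$ from $S$ to $S$; write $F_s$ for $F(s,\cdot)$; $(\mathbb{X}g)(s)=\int g\,dF_s$ for measurable $g:S\to[0,\infty]$, applied componentwise to vector-valued functions. $\{1,\dots,d\}$ has the discrete $\sigma$-algebra. On $[0,\infty]^n$ define $(r_1,\dots,r_n)\succ(r'_1,\dots,r'_n)$ iff there is $l$ with $r_i\ge r'_i$ for all $i<l$ and $r_l\ge1+r'_l$; $r\succeq r'$ iff $r\succ r'$ or $r_i\ge r'_i$ for all $i$. For $x=(x_1,\dots,x_d)$ let $x\downharpoonright i=(x_1,\dots,x_i)$, and write $x\succeq_i y$ iff $x\downharpoonright i\succeq y\downharpoonright i$ and $x\succ_i y$ iff $x\downharpoonright i\succ y\downharpoonright i$. A progress-measure supermartingale (PMSM) for $(F,p)$ is a measurable $r:S\to[0,\infty)^d$ such that for every $x\in S$: if $p(x)$ is even then $r(x)\succeq_{p(x)}(\mathbb{X}r)(x)$, and if $p(x)$ is odd then $r(x)\succ_{p(x)}(\mathbb{X}r)(x)$. For $x_0\in S$, $\mathbb{P}_{x_0}$ is the unique probability measure on $S^\omega$ (cylinder $\sigma$-algebra) of trajectories $x_1x_2\dots$ such that for measurable $g:S^n\to[0,\infty]$, $\int g(x_1,\dots,x_n)\,d\mathbb{P}_{x_0}=\int\cdots\int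 g\,dF_{x_{n-1}}(x_n)\cdots dF_{x_0}(x_1)$. $\mathbf{Parity}(p)\subseteq S^\omega$ is the set of sequences whose minimal priority occurring infinitely often is even. *)

(* Defs.v *)
From HB Require Import structures.
From mathcomp Require Import all_boot all_order all_algebra.
From mathcomp Require Import all_classical all_reals all_analysis.
From mathcomp Require Import measurable_realfun.

Set Implicit Arguments.
Unset Strict Implicit.
Unset Printing Implicit Defensive.
Import Order.TTheory GRing.Theory Num.Theory.

Local Open Scope classical_set_scope.
Local Open Scope ring_scope.
Local Open Scope ereal_scope.

(* The orders on [0, +oo]^n, for tuples of extended reals; they are only used
   on tuples with nonnegative components. *)
Section lexicographic.
Context {R : realType}.

Definition lex_succ n (r r' : n.-tuple (\bar R)) : Prop :=
  exists l : 'I_n,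
    (forall i : 'I_n, (i < l)%N -> tnth r' i <= tnth r i) /\
    1 + tnth r' l <= tnth r l.

Definition lex_succeq n (r r' : n.-tuple (\bar R)) : Prop :=
  lex_succ r r' \/ forall i : 'I_n, tnth r' i <= tnth r i.

(* The prefix (x_1, ..., x_i) has static length [minn i d]. *)
Definition take_first d (i : nat) (x : d.-tuple (\bar R)) :
    (minn i d).-tuple (\bar R) :=
  [tuple of take i x].

Definition lex_succ_at d (i : nat) (x y : d.-tuple (\bar R)) : Prop :=
  lex_succ (take_first i x) (take_first i y).

Definition lex_succeq_at d (i : nat) (x y : d.-tuple (\bar R)) : Prop :=
  lex_succeq (take_first i x) (take_first i y).

End lexicographic.

Section chain.
Context {R : realType} {disp : measure_display} {S : measurableType disp}.
Implicit Type F : R.-pker S ~> S.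

Definition next_exp F (g : S -> \bar R) (s : S) : \bar R := \int[F s]_t g t.

Definition next_exp_tuple F d (r : S -> d.-tuple (\bar R)) (s : S) :
    d.-tuple (\bar R) :=
  [tuple next_exp F (fun t => tnth (r t) i) s | i < d].

(* The priorities 1, ..., d are natural numbers, and [nat] carries the discrete
   sigma-algebra. *)
Definition priority_function (d : nat) (p : S -> nat) : Prop :=
  measurable_fun setT p /\ forall x, (1 <= p x <= d)%N.

Definition etuple {d} (x : d.-tuple R) : d.-tuple (\bar R) :=
  [tuple (tnth x i)%:E | i < d].

Record PMSM F (d : nat) (p : S -> nat) (r : S -> d.-tuple R) : Prop := {
  pmsm_measurable : measurable_fun setT r ;
  pmsm_ge0 : forall x i, (0 <= tnth (r x) i)%R ;
  pmsm_even : forall x, ~~ odd (p x) ->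
    lex_succeq_at (p x) (etuple (r x)) (next_exp_tuple F (@etuple d \o r) x) ;
  pmsm_odd : forall x, odd (p x) ->
    lex_succ_at (p x) (etuple (r x)) (next_exp_tuple F (@etuple d \o r) x)
}.

End chain.

Section trajectories.
Context {disp : measure_display}.

Definition cylinders (S : measurableType disp) : set (set (nat -> S)) :=
  [set C | exists n (A : set S), measurable A /\ C = [set w | A (w n)]].

(* A trajectory x_1 x_2 ... is a function w with w n = x_(n+1). *)
Definition trajectory (S : measurableType disp) :=
  g_sigma_algebraType (@cylinders S).

Context {R : realType} {S : measurableType disp}.
Implicit Type F : R.-pker S ~> S.

Definition prefix_tuple (n : nat) (w : trajectory S) : n.-tuple S :=
  [tuple (w : nat -> S) i | i < n].

(* \int ... \int g(x_1, ..., x_n) dF_(x_(n-1))(x_n) ... dF_(x_0)(x_1) *)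
Fixpoint iterated_integral F (n : nat) (x0 : S) :
    (n.-tuple S -> \bar R) -> \bar R :=
  match n return (n.-tuple S -> \bar R) -> \bar R with
  | 0%N => fun g => g [tuple]
  | m.+1 => fun g => \int[F x0]_x1
      iterated_integral F x1 (fun t : m.-tuple S => g [tuple of x1 :: t])
  end.

Definition is_trajectory_measure F (x0 : S)
    (P : probability (trajectory S) R) : Prop :=
  forall (n : nat) (g : n.-tuple S -> \bar R),
    measurable_fun [set: n.-tuple S] g -> (forall t, 0 <= g t) ->
    \int[P]_w g (prefix_tuple n w) = iterated_integral F x0 g.

Definition infinitely_often (p : S -> nat) (w : trajectory S) : set nat :=
  [set k | infinite_set [set n | p ((w : nat -> S) n) = k]].

Definition Parity (p : S -> nat) : set (trajectory S) :=
  [set w | exists k : nat,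
    [/\ infinitely_often p w k,
        forall j, infinitely_often p w j -> (k <= j)%N & ~~ odd k]].

End trajectories.

(* Main.v *)
(* Write [f_l] for the [l]-th component of the progress measure and [X] for the
   one-step expectation. If a trajectory violates parity, let [k] be the (odd)
   least priority occurring infinitely often. Every visit to [k] is a
   lexicographic drop at some level below [k]; let [l] be the least level of
   drop occurring infinitely often. Then eventually no priority is below [k]
   and no drop is at a level below [l], so eventually [X f_l <= f_l], while
   [1 + X f_l <= f_l] infinitely often. For a single level, this event is null:
   start at a time [N] with [f_l <= M] and kill the chain when [X f_l <= f_l]
   fails; the expectation of [f_l] then drops by the probability of a visit to
   [1 + X f_l <= f_l], so these probabilities sum to at most [M], and
   Borel-Cantelli applies. *)
Require Import Defs.
From mathcomp Require Import all_boot all_order all_algebra.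
From mathcomp Require Import all_classical all_reals all_analysis.
From mathcomp Require Import measurable_realfun.
Set Implicit Arguments.
Unset Strict Implicit.
Unset Printing Implicit Defensive.
Import Order.TTheory GRing.Theory Num.Theory.

Local Open Scope classical_set_scope.
Local Open Scope ring_scope.
Local Open Scope ereal_scope.

(** * Events holding infinitely often or eventually in time *)

Section infinitely_often.
Implicit Type A : nat -> Prop.

Lemma infinite_set_natP A :
  infinite_set [set n | A n] <-> forall m, exists2 n, (m <= n)%N & A n.
Proof.
split=> [Ainf m|Aio /finite_seqP[s As]].
  apply: contrapT => Am; apply: Ainf.
  apply: (@sub_finite_set _ _ `I_m) => [n /= An|]; last exact: finite_II.
  by rewrite ltnNge; apply/negP => mn; apply: Am; exists n.
(* If the times are listed by [s], an occurrence beyond the maximum of [s] cannot belong to the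
   list. *)
have [n sn An] := Aio (\max_(i <- s) i)%N.+1.
have : [set n | A n] n by [].
rewrite As /= => ns.
by have := @leq_bigmax_seq _ s xpredT id n ns isT; rewrite leqNgt sn.
Qed.

Lemma eventually_forall_lt (Q : nat -> nat -> Prop) k :
  (forall l, (l < k)%N -> exists N, forall n, (N <= n)%N -> Q l n) ->
  exists N, forall n, (N <= n)%N -> forall l, (l < k)%N -> Q l n.
Proof.
elim: k => [|k IHk] Qev; first by exists 0%N.
have [l lk|N QN] := IHk; first by apply: Qev; exact: ltnW.
have [M QM] := Qev k (ltnSn k).
exists (maxn N M) => n; rewrite geq_max => /andP[Nn Mn] l.
rewrite ltnS leq_eqVlt => /predU1P[->|lk]; first exact: QM.
exact: QN.
Qed.

Lemma not_io A : ~ (forall m, exists2 n, (m <= n)%N & A n) ->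
  exists N, forall n, (N <= n)%N -> ~ A n.
Proof.
by move=> /existsNP[N NA]; exists N => n Nn An; apply: NA; exists n.
Qed.

(** If each of the finitely many [l] stopped occurring, a common threshold would exist past which
    none occurs. *)
Lemma io_pigeonhole (A : nat -> nat -> Prop) k :
  (forall m, exists2 n, (m <= n)%N & exists2 l, (l < k)%N & A l n) ->
  exists2 l, (l < k)%N & forall m, exists2 n, (m <= n)%N & A l n.
Proof.
move=> Aio; apply: contrapT => noA.
have [l lk|N AN] := @eventually_forall_lt (fun l n => ~ A l n) k.
  by apply: not_io => Al; apply: noA; exists l.
have [n Nn [l lk Aln]] := Aio N.
exact: AN Nn l lk Aln.
Qed.

Lemma least_nat (A : nat -> Prop) n : A n ->
  exists2 k, A k & forall j, A j -> (k <= j)%N.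
Proof.
move=> An; have Aex : exists n, `[< A n >] by exists n; apply/asboolP.
case: (ex_minnP Aex) => k /asboolP Ak kmin.
by exists k => // j Aj; apply: kmin; apply/asboolP.
Qed.

End infinitely_often.

(** * One-step drift of a single nonnegative function *)

Section drift.
Context {R : realType} {disp : measure_display} {S : measurableType disp}.
Context (F : R.-pker S ~> S).
Implicit Type f : S -> \bar R.

Definition nonincreasing_at f : set S := [set x | next_exp F f x <= f x].

Definition decreasing_at f : set S := [set x | 1 + next_exp F f x <= f x].

Lemma decreasing_nonincreasing f : decreasing_at f `<=` nonincreasing_at f.
Proof. by move=> x; apply: le_trans; rewrite leeDr. Qed.

Lemma next_exp_ge0 f : (forall x, 0 <= f x) -> forall x, 0 <= next_exp F f x.
Proof. by move=> f0 x; exact: integral_ge0. Qed.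

Lemma measurable_next_exp f : measurable_fun setT f -> (forall x, 0 <= f x) ->
  measurable_fun setT (next_exp F f).
Proof.
move=> mf f0; apply: (measurable_fun_integral_kernel (l := F)) => // U mU.
exact: measurable_kernel.
Qed.

Lemma measurable_nonincreasing_at f :
  measurable_fun setT f -> (forall x, 0 <= f x) ->
  measurable (nonincreasing_at f).
Proof.
move=> mf f0; rewrite -[X in measurable X]setTI.
by apply: measurable_lee => //; exact: measurable_next_exp.
Qed.

Lemma measurable_decreasing_at f :
  measurable_fun setT f -> (forall x, 0 <= f x) ->
  measurable (decreasing_at f).
Proof.
move=> mf f0; rewrite -[X in measurable X]setTI.
apply: measurable_lee => //; apply: emeasurable_funD => //.
exact: measurable_next_exp.
Qed.

End drift.

(** * The lexicographic conditions read level by level *)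

Section lexicographic_drift.
Context {R : realType} {disp : measure_display} {S : measurableType disp}.
Context (F : R.-pker S ~> S) (d : nat) (r : S -> d.-tuple R).

(** Levels are plain naturals, counted from 0, so that prefixes of different lengths share one index
    type. Levels from [d] on are constantly 0. *)
Definition component (l : nat) (x : S) : \bar R := (nth 0%R (r x) l)%:E.

(** Several [l] may qualify at the same [x]: lower levels are allowed to drop as well. *)
Definition decreases_first (l : nat) : set S := [set x |
  (forall i, (i < l)%N -> nonincreasing_at F (component i) x) /\
  decreasing_at F (component l) x].

Lemma tnth_take_etuple i x (j : 'I_(minn i d)) :
  tnth (take_first i (etuple (r x))) j = component j x.
Proof.
have jd : (j < d)%N by have := ltn_ord j; rewrite leq_min => /andP[].
have ji : (j < i)%N by have := ltn_ord j; rewrite leq_min => /andP[].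
rewrite (tnth_nth 0) nth_take//.
by rewrite (nth_mktuple _ _ (Ordinal jd)) (tnth_nth 0%R).
Qed.

Lemma tnth_take_next_exp_tuple i x (j : 'I_(minn i d)) :
  tnth (take_first i (next_exp_tuple F (@etuple R d \o r) x)) j =
  next_exp F (component j) x.
Proof.
have jd : (j < d)%N by have := ltn_ord j; rewrite leq_min => /andP[].
have ji : (j < i)%N by have := ltn_ord j; rewrite leq_min => /andP[].
rewrite (tnth_nth 0) nth_take// (nth_mktuple _ _ (Ordinal jd)).
by apply: eq_integral => y _; rewrite /= tnth_mktuple (tnth_nth 0%R).
Qed.

Lemma lex_succ_at_decreases i x :
  lex_succ_at i (etuple (r x)) (next_exp_tuple F (@etuple R d \o r) x) ->
  exists2 l, (l < i)%N & decreases_first l x.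
Proof.
move=> [l []]; rewrite tnth_take_etuple tnth_take_next_exp_tuple => le1 lt1.
have : (l < minn i d)%N := ltn_ord l; rewrite leq_min => /andP[li _].
exists l => //; split=> // j jl.
have := le1 (Ordinal (ltn_trans jl (ltn_ord l))) jl.
by rewrite tnth_take_etuple tnth_take_next_exp_tuple.
Qed.

Lemma lex_succeq_at_decreases i x : (i <= d)%N ->
  lex_succeq_at i (etuple (r x)) (next_exp_tuple F (@etuple R d \o r) x) ->
  (exists2 l, (l < i)%N & decreases_first l x) \/
  forall l, (l < i)%N -> nonincreasing_at F (component l) x.
Proof.
move=> id [/lex_succ_at_decreases|le1]; [by left|right => l li].
(* Since [i <= d], the truncated prefix really has length [i], so every level below [i] is
   compared. *)
have lm : (l < minn i d)%N by rewrite leq_min li (leq_trans li).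
have := le1 (Ordinal lm).
by rewrite tnth_take_etuple tnth_take_next_exp_tuple.
Qed.

Lemma measurable_component l :
  measurable_fun setT r -> measurable_fun setT (component l).
Proof.
move=> mr; apply/measurable_EFinP.
have [dl|ld] := leqP d l.
  rewrite (_ : (fun _ => _) = cst 0%R) //.
  by apply/funext => x; rewrite nth_default ?size_tuple.
rewrite (_ : (fun _ => _) = (@tnth d R)^~ (Ordinal ld) \o r).
  by apply: measurableT_comp => //; exact: measurable_tnth.
by apply/funext => x; rewrite /= (tnth_nth 0%R).
Qed.

Lemma component_ge0 : (forall x i, (0 <= tnth (r x) i)%R) ->
  forall l x, 0 <= component l x.
Proof.
move=> r0 l x; rewrite lee_fin; have [dl|ld] := leqP d l.
  by rewrite nth_default ?size_tuple.
by have := r0 x (Ordinal ld); rewrite (tnth_nth 0%R).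
Qed.

End lexicographic_drift.

(** * From a parity violation to one drifting level *)

Lemma not_Parity_drift {R : realType} {disp : measure_display}
    {S : measurableType disp} (F : R.-pker S ~> S) (d : nat) (p : S -> nat)
    (r : S -> d.-tuple R) (w : trajectory S) :
  priority_function d p -> PMSM F p r -> ~ Parity p w ->
  exists l,
    (exists N, forall n, (N <= n)%N ->
      nonincreasing_at F (component r l) ((w : nat -> S) n)) /\
    (forall m, exists2 n, (m <= n)%N &
      decreasing_at F (component r l) ((w : nat -> S) n)).
Proof.
move=> [_ pd] hr wP.
have [k kd kio] : exists2 k, (k < d.+1)%N & infinitely_often p w k.
  have [m|k kd kio] := @io_pigeonhole (fun k n => p ((w : nat -> S) n) = k) d.+1.
    exists m => //; exists (p ((w : nat -> S) m)) => //.
    by rewrite ltnS; have /andP[] := pd ((w : nat -> S) m).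
  by exists k => //; apply/infinite_set_natP.
have {k kd kio} [k kio kmin] := least_nat kio.
have kodd : odd k.
  by apply: contrapT => /negP ko; apply: wP; exists k; split.
have [N0 kN] : exists N, forall n, (N <= n)%N -> (k <= p ((w : nat -> S) n))%N.
  have [j jk|N pN] := @eventually_forall_lt
      (fun j n => p ((w : nat -> S) n) <> j) k.
    apply: not_io => jio; have /kmin : infinitely_often p w j.
      exact/infinite_set_natP.
    by rewrite leqNgt jk.
  exists N => n Nn; rewrite leqNgt; apply/negP => pk.
  exact: pN n Nn _ pk erefl.
have [l0 l0k l0io] : exists2 l, (l < k)%N & forall m, exists2 n, (m <= n)%N &
    decreases_first F r l ((w : nat -> S) n).
  apply: (@io_pigeonhole
    (fun l n => decreases_first F r l ((w : nat -> S) n)) k) => m.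
  have [n mn pn] := (infinite_set_natP _).1 kio m.
  exists n => //; rewrite -pn; apply: lex_succ_at_decreases.
  by apply: (pmsm_odd hr); rewrite pn.
have [l lio lmin] := @least_nat
  (fun l => forall m, exists2 n, (m <= n)%N &
    decreases_first F r l ((w : nat -> S) n)) _ l0io.
have lk : (l < k)%N by apply: leq_ltn_trans l0k; exact: lmin.
have [N1 lN] : exists N, forall n, (N <= n)%N -> forall j, (j < l)%N ->
    ~ decreases_first F r j ((w : nat -> S) n).
  apply: (@eventually_forall_lt
    (fun j n => ~ decreases_first F r j ((w : nat -> S) n))) => j jl.
  by apply: not_io => /lmin; rewrite leqNgt jl.
exists l; split; last first.
  by move=> m; have [n mn []] := lio m; exists n.
exists (maxn N0 N1) => n; rewrite geq_max => /andP[/kN kp /lN lNn].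
have lp : (l < p ((w : nat -> S) n))%N := leq_trans lk kp.
(* A drop at this late time has level [j >= l]. If [l < j], then [l] is among the levels that do not
   increase; if [j = l], it drops itself. *)
have first_drop : (exists2 j, (j < p ((w : nat -> S) n))%N &
    decreases_first F r j ((w : nat -> S) n)) ->
    nonincreasing_at F (component r l) ((w : nat -> S) n).
  move=> [j _ jA]; have := jA; rewrite /decreases_first /= => -[jG jD].
  have [jl|lj|<-] := ltngtP j l; first by case: (lNn j jl).
    exact: jG.
  exact: decreasing_nonincreasing.
have [po|pe] := boolP (odd (p ((w : nat -> S) n))).
  by apply/first_drop/lex_succ_at_decreases/(pmsm_odd hr).
(* At an even priority there is either a drop, treated as above, or no increase at any level below
   the priority, among them [l]. *)
have [|//|] := @lex_succeq_at_decreases _ _ _ F d r _ _ _ (pmsm_even hr pe).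
- by have /andP[] := pd ((w : nat -> S) n).
- exact.
Qed.

(** * Killed expectations and the Markov property *)

Section path_weight.
Context {R : realType} {disp : measure_display} {S : measurableType disp}.
Implicit Types (F : R.-pker S ~> S) (B : nat -> set S) (h : S -> \bar R).

(** The path is killed if it is outside [B i] at a time [i < n]. Time [n] is left to [h], which
    carries the factor for [B n] when it is wanted. *)
Definition path_weight n B h (w : nat -> S) : \bar R :=
  (\prod_(i < n) \1_(B i) (w i))%R%:E * h (w n).

(** The same weight as a function of the first [n.+1] states, the form to which the defining
    equation of the trajectory measure applies. *)
Definition tuple_weight n B h (t : n.+1.-tuple S) : \bar R :=
  (\prod_(i < n) \1_(B i) (tnth t (widen_ord (leqnSn n) i)))%R%:E *
  h (tnth t ord_max).

Lemma tuple_weight_prefix n B h (w : trajectory S) :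
  tuple_weight B h (prefix_tuple n.+1 w) = path_weight n B h w.
Proof.
rewrite /tuple_weight /path_weight tnth_mktuple.
by under eq_bigr do rewrite tnth_mktuple.
Qed.

Lemma tuple_weight_cons n B h x (t : n.+1.-tuple S) :
  tuple_weight B h [tuple of x :: t] =
  (\1_(B 0%N) x)%:E * tuple_weight (fun i => B i.+1) h t.
Proof.
rewrite /tuple_weight big_ord_recl EFinM -muleA; congr (_ * (_ * _)).
- by congr EFin; apply: eq_bigr => i _; rewrite !(tnth_nth x).
- by rewrite !(tnth_nth x).
Qed.

Lemma indic_prod_ge0 n (A : 'I_n -> set S) (u : 'I_n -> S) :
  (0 <= \prod_(i < n) \1_(A i) (u i) :> R)%R.
Proof. by apply: prodr_ge0 => i _; rewrite indicE. Qed.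

Lemma path_weight_ge0 n B h w : (forall x, 0 <= h x) -> 0 <= path_weight n B h w.
Proof. by move=> h0; rewrite mule_ge0// lee_fin indic_prod_ge0. Qed.

Lemma tuple_weight_ge0 n B h (t : n.+1.-tuple S) :
  (forall x, 0 <= h x) -> 0 <= tuple_weight B h t.
Proof. by move=> h0; rewrite mule_ge0// lee_fin indic_prod_ge0. Qed.

Lemma measurable_tuple_weight n B h :
  (forall i, measurable (B i)) -> measurable_fun setT h ->
  measurable_fun setT (@tuple_weight n B h).
Proof.
move=> mB mh; apply: emeasurable_funM.
  apply/measurable_EFinP; apply: measurable_prod => i _.
  apply: measurableT_comp; last exact: measurable_tnth.
  exact: measurable_indic.
by apply: measurableT_comp => //; exact: measurable_tnth.
Qed.

Lemma measurable_coord n : measurable_fun setT (fun w : trajectory S => (w : nat -> S) n).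
Proof.
move=> _ A mA; rewrite setTI; apply: sub_sigma_algebra.
by exists n, A; split.
Qed.

Lemma measurable_path_weight n B h :
  (forall i, measurable (B i)) -> measurable_fun setT h ->
  measurable_fun setT (path_weight n B h : trajectory S -> \bar R).
Proof.
move=> mB mh; apply: emeasurable_funM.
  apply/measurable_EFinP; apply: measurable_prod => i _.
  by apply: measurableT_comp; [exact: measurable_indic|exact: measurable_coord].
by apply: measurableT_comp => //; exact: measurable_coord.
Qed.

Lemma iterated_integralS F n x0 (g : n.+1.-tuple S -> \bar R) :
  iterated_integral F x0 g =
  \int[F x0]_x iterated_integral F x (fun t => g [tuple of x :: t]).
Proof. by []. Qed.

(** The innermost integral, over the last state, is evaluated. The constant [c] strengthens the
    induction: it collects the indicators of states already split off at the front. *)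
Lemma iterated_integral_markov F B h n (c : R) x0 :
  (forall i, measurable (B i)) -> measurable_fun setT h ->
  (forall x, 0 <= h x) -> (0 <= c)%R ->
  iterated_integral F x0 (fun t : n.+2.-tuple S => c%:E * tuple_weight B h t) =
  iterated_integral F x0 (fun t : n.+1.-tuple S =>
    c%:E * tuple_weight B (fun x => (\1_(B n) x)%:E * next_exp F h x) t).
Proof.
elim: n B c x0 => [|n IHn] B c x0 mB mh h0 c0.
  rewrite /=; apply: eq_integral => x _.
  under eq_integral => y _.
    rewrite tuple_weight_cons /tuple_weight big_ord0 mul1e.
    rewrite (_ : tnth _ _ = y); last by rewrite (tnth_nth x).
    rewrite muleA -EFinM.
    over.
  rewrite ge0_integralZl_EFin//; last by rewrite mulr_ge0// indicE.
  rewrite /tuple_weight big_ord0 mul1e EFinM -muleA.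
  by rewrite (_ : tnth _ _ = x)//; rewrite (tnth_nth x).
rewrite [LHS]iterated_integralS [RHS]iterated_integralS.
apply: eq_integral => x _.
(* Splitting off the first state moves its indicator into the constant and shifts [B] by one time
   unit. *)
have shift m h' : (fun t : m.+1.-tuple S =>
    c%:E * tuple_weight B h' [tuple of x :: t]) =
  (fun t => (c * \1_(B 0%N) x)%:E * tuple_weight (fun i => B i.+1) h' t).
  by apply/funext => t; rewrite tuple_weight_cons muleA EFinM.
rewrite !shift IHn//.
by rewrite mulr_ge0// indicE.
Qed.

Context (F : R.-pker S ~> S) (x0 : S) (P : probability (trajectory S) R).
Context (hP : is_trajectory_measure F x0 P).

Lemma markov_property B h n :
  (forall i, measurable (B i)) -> measurable_fun setT h ->
  (forall x, 0 <= h x) ->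
  \int[P]_w path_weight n.+1 B h w =
  \int[P]_w path_weight n B (fun x => (\1_(B n) x)%:E * next_exp F h x) w.
Proof.
move=> mB mh h0.
have mh' : measurable_fun setT (fun x => (\1_(B n) x)%:E * next_exp F h x).
  apply: emeasurable_funM; last exact: measurable_next_exp.
  by apply/measurable_EFinP; exact: measurable_indic.
have h'0 x : 0 <= (\1_(B n) x)%:E * next_exp F h x.
  by rewrite mule_ge0 ?next_exp_ge0// lee_fin indicE.
under eq_integral do rewrite -tuple_weight_prefix.
under [RHS]eq_integral do rewrite -tuple_weight_prefix.
rewrite (hP (measurable_tuple_weight mB mh)); last first.
  by move=> t; exact: tuple_weight_ge0.
rewrite (hP (measurable_tuple_weight mB mh')); last first.
  by move=> t; exact: tuple_weight_ge0.
have := @iterated_integral_markov F B h n 1 x0 mB mh h0 ler01.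
by under eq_fun do rewrite mul1e; under [in RHS]eq_fun do rewrite mul1e.
Qed.

(** * Visits of the killed chain and Borel-Cantelli *)

Definition visits B (D : set S) n : set (trajectory S) :=
  [set w | (forall i, (i <= n)%N -> B i ((w : nat -> S) i)) /\
           D ((w : nat -> S) n)].

Lemma measurable_visits B D n :
  (forall i, measurable (B i)) -> measurable D -> measurable (visits B D n).
Proof.
move=> mB mD.
rewrite (_ : visits B D n =
    \bigcap_(i in [set i | (i <= n)%N])
      ((fun w : trajectory S => (w : nat -> S) i) @^-1` B i) `&`
    (fun w : trajectory S => (w : nat -> S) n) @^-1` D); last by apply/seteqP; split.
have mcoord i A : measurable A ->
    measurable ((fun w : trajectory S => (w : nat -> S) i) @^-1` A).
  by move=> mA; rewrite -[X in measurable X]setTI; exact: measurable_coord.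
apply: measurableI; last exact: mcoord.
by apply: bigcap_measurableType => i _; exact: mcoord.
Qed.

(** This puts visit probabilities in the form of killed expectations, so that they can be added to
    those of [f] under one integral. *)
Lemma visits_integral B D n :
  (forall i, measurable (B i)) -> measurable D ->
  P (visits B D n) =
  \int[P]_w path_weight n B (fun x => (\1_(B n) x)%:E * (\1_D x)%:E) w.
Proof.
move=> mB mD; have := integral_indic P measurableT (measurable_visits n mB mD).
rewrite setIT => <-; apply: eq_integral => w _.
rewrite /path_weight muleA -EFinM.
have -> : (\prod_(i < n) \1_(B i) ((w : nat -> S) i) *
    \1_(B n) ((w : nat -> S) n) =
    \prod_(i < n.+1) \1_(B i) ((w : nat -> S) i) :> R)%R by rewrite big_ord_recr.
congr EFin; rewrite indicE.
case: (pselect (forall i, (i <= n)%N -> B i ((w : nat -> S) i))) => [Bw|].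
  rewrite big1 ?mul1r => [|i _]; last first.
    by rewrite indicE mem_set//; apply: Bw; rewrite -ltnS.
  rewrite indicE; congr (_%:R); congr nat_of_bool.
  by apply/idP/idP; rewrite !inE => // -[].
move=> nB; rewrite memNset//=; last by case.
(* A time at which the path is outside its set contributes a zero factor to the product. *)
have [i /not_implyP[ni Bi]] := (existsNP _).2 nB.
have ni' : (i < n.+1)%N by rewrite ltnS.
by rewrite (bigD1 (Ordinal ni'))//= indicE memNset// !mul0r.
Qed.

Lemma visits_finitely_often B D f N (M : R) :
  (forall i, measurable (B i)) -> measurable D ->
  measurable_fun setT f -> (forall x, 0 <= f x) ->
  (forall n x, (N <= n)%N -> B n x -> next_exp F f x + (\1_D x)%:E <= f x) ->
  (forall x, B N x -> f x <= M%:E) ->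
  P (lim_sup_set (fun k => visits B D (N + k)%N)) = 0.
Proof.
move=> mB mD mf f0 drop fM.
pose stay n h x : \bar R := (\1_(B n) x)%:E * h x.
have stay_ge0 n h : (forall x, 0 <= h x) -> forall x, 0 <= stay n h x.
  by move=> h0 x; rewrite mule_ge0// lee_fin indicE.
have mstay n h : measurable_fun setT h -> measurable_fun setT (stay n h).
  move=> mh; apply: emeasurable_funM => //.
  by apply/measurable_EFinP; exact: measurable_indic.
have mD1 : measurable_fun setT (fun x => (\1_D x)%:E : \bar R).
  by apply/measurable_EFinP; exact: measurable_indic.
have D10 x : 0 <= ((\1_D x)%:E : \bar R) by rewrite lee_fin indicE.
have Xf0 := next_exp_ge0 F f0.
have mXf := measurable_next_exp F mf f0.
pose a n := \int[P]_w path_weight n B (stay n f) w.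
(* [a n] is the expectation of [f] at time [n] on the event that the trajectory
   has stayed in [B] so far; it pays for the visits to [D]. *)
have a_decr n : (N <= n)%N -> a n.+1 + P (visits B D n) <= a n.
  move=> Nn.
  have aX : a n.+1 <= \int[P]_w path_weight n B (stay n (next_exp F f)) w.
    (* Undoing the conditioning gives the expectation of [f] at time [n.+1] without killing at that
       time; killing there can only lower it. *)
    rewrite -(@markov_property B f n)//; apply: ge0_le_integral => //.
    - by move=> w _; apply: path_weight_ge0; exact: stay_ge0.
    - by apply: measurable_path_weight => //; exact: mstay.
    - exact: measurable_path_weight.
    - move=> w _; apply: lee_wpmul2l; first by rewrite lee_fin indic_prod_ge0.
      by rewrite /stay gee_pMl// ?ge0_fin_numE// ?lee_fin indicE// lern1 leq_b1.
  rewrite visits_integral//; apply: le_trans (leeD2r _ aX) _.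
  rewrite -ge0_integralD//; first last.
  - by apply: measurable_path_weight => //; exact: mstay.
  - by move=> w _; apply: path_weight_ge0; exact: (stay_ge0 n _ D10).
  - by apply: measurable_path_weight => //; exact: mstay.
  - by move=> w _; apply: path_weight_ge0; exact: stay_ge0.
  apply: ge0_le_integral => //.
  - move=> w _; apply: adde_ge0; apply: path_weight_ge0.
      exact: stay_ge0.
    exact: (stay_ge0 n _ D10).
  - by apply: emeasurable_funD; apply: measurable_path_weight => //; exact: mstay.
  - by apply: measurable_path_weight => //; exact: mstay.
  - move=> w _; rewrite /path_weight -ge0_muleDr; first last.
    + exact: (stay_ge0 n _ D10).
    + exact: stay_ge0.
    apply: lee_wpmul2l; first by rewrite lee_fin indic_prod_ge0.
    rewrite /stay -ge0_muleDr//.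
    rewrite indicE; have [Bw|Bw] := boolP (_ \in _); last by rewrite !mul0e.
    by rewrite !mul1e; apply: (drop n) => //; exact: set_mem Bw.
have a0 n : 0 <= a n.
  by apply: integral_ge0 => w _; apply: path_weight_ge0; exact: stay_ge0.
(* The absolute value keeps the bound nonnegative, as required on paths outside [B N], where the
   weight is 0. *)
have aN : a N <= `|M|%:E.
  rewrite -[leRHS]mule1 -(@probability_setT _ _ _ P) -integral_cst//.
  apply: ge0_le_integral => //.
  - by move=> w _; apply: path_weight_ge0; exact: stay_ge0.
  - by apply: measurable_path_weight => //; exact: mstay.
  - move=> w _; rewrite /path_weight /stay indicE.
    have [Bw|Bw] := boolP (_ \in _); last by rewrite mul0e mule0 lee_fin.
    rewrite mul1e -[leRHS]mul1e; apply: lee_pmul => //.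
    - by rewrite lee_fin indic_prod_ge0.
    - rewrite lee_fin; apply: prodr_ile1 => i _.
      by rewrite indicE ler0n lern1 leq_b1.
    - by apply: le_trans (fM _ (set_mem Bw)) _; rewrite lee_fin ler_norm.
apply: lim_sup_set_cvg0 => [k|]; first exact: measurable_visits.
apply: (@le_lt_trans _ _ `|M|%:E); last exact: ltry.
apply: lime_le; first exact: is_cvg_nneseries.
apply: nearW => m; apply: le_trans aN.
(* The term [a (N + m)] makes the sum telescope; being nonnegative, it can then be dropped. *)
suff : a (N + m)%N + \sum_(0 <= k < m) P (visits B D (N + k)) <= a N.
  by apply: le_trans; rewrite leeDr.
elim: m => [|m IHm]; first by rewrite big_geq// addn0 adde0.
rewrite big_nat_recr//= addnS [X in _ + X]addeC addeA.
apply: le_trans IHm; apply: leeD2r; apply: a_decr; exact: leq_addr.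
Qed.

(** The starting time [N] and the bound on [f] at that time depend on the trajectory. Both range
    over naturals, the bound because [f] is finite, so countably many null events cover the set. *)
Lemma drift_negligible f :
  measurable_fun setT f -> (forall x, 0 <= f x) -> (forall x, f x < +oo) ->
  P.-negligible [set w : trajectory S |
    (exists N, forall n, (N <= n)%N ->
      nonincreasing_at F f ((w : nat -> S) n)) /\
    (forall m, exists2 n, (m <= n)%N & decreasing_at F f ((w : nat -> S) n))].
Proof.
move=> mf f0 foo; pose G := nonincreasing_at F f; pose D := decreasing_at F f.
have mG : measurable G by exact: measurable_nonincreasing_at.
have mD : measurable D by exact: measurable_decreasing_at.
(* There is no constraint before [N]; from [N] on the path stays in [G], and at [N] itself [f] is
   also bounded by [M]. *)
pose B N (M : nat) i : set S :=
  if (i < N)%N then setT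
  else if i == N then G `&` [set x | f x <= M%:R%:E] else G.
have mB N M i : measurable (B N M i).
  rewrite /B; case: ifP => // _; case: ifP => // _; apply: measurableI => //.
  by rewrite -[X in measurable X]setTI; exact: measurable_lee.
have B0 N M : P (lim_sup_set (fun k => visits (B N M) D (N + k)%N)) = 0.
  apply: (@visits_finitely_often _ _ f N M%:R) => // [n x Nn|x].
    rewrite /B ltnNge Nn /= => Bx.
    have Gx : G x by move: Bx; case: ifP => // _ [].
    rewrite indicE; have [Dx|Dx] := boolP (x \in D); last by rewrite adde0.
    by rewrite addeC; exact: set_mem Dx.
  by rewrite /B ltnn eqxx => -[].
have : P.-negligible (\bigcup_N \bigcup_M
    lim_sup_set (fun k => visits (B N M) D (N + k)%N)).
  apply: negligible_bigcup => N; apply: negligible_bigcup => M.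
  exists (lim_sup_set (fun k => visits (B N M) D (N + k)%N)); split; [|exact: B0|by []].
  apply: bigcap_measurableType => i _.
  by apply: bigcup_measurable => j _; exact: measurable_visits.
move=> negl; apply: negligibleS negl => w /= [[N GN] Dio].
exists N => //; have [M fM] : exists M : nat, f ((w : nat -> S) N) <= M%:R%:E.
  have ffin : f ((w : nat -> S) N) \is a fin_num by rewrite ge0_fin_numE.
  exists (Num.truncn (fine (f ((w : nat -> S) N)))).+1.
  by rewrite -(fineK ffin) lee_fin ltW// truncnS_gt.
(* The limit superior counts time from [N], so a visit at a time [n >= N + m] is taken and indexed
   by [n - N]. *)
exists M => // m _; have [n mn Dn] := Dio (N + m)%N.
have Nn : (N <= n)%N := leq_trans (leq_addr _ _) mn.
exists (n - N)%N; first by rewrite /= leq_subRL.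
rewrite subnKC//; split => // i ni; rewrite /B.
case: ltnP => // Ni; case: eqP => [iN|_]; last exact: GN.
by split; [exact: GN|rewrite /= iN].
Qed.

End path_weight.

(** * Measurability of parity, and the conclusion *)

Lemma measurable_Parity {disp : measure_display} {S : measurableType disp}
    (p : S -> nat) : measurable_fun setT p -> measurable (Parity p).
Proof.
move=> mp.
have mio k : measurable [set w : trajectory S | infinitely_often p w k].
  rewrite (_ : [set _ | _] = lim_sup_set (fun n =>
      [set w : trajectory S | p ((w : nat -> S) n) = k])).
    apply: bigcap_measurableType => i _; apply: bigcup_measurable => n _.
    rewrite -[X in measurable X]setTI.
    exact: (measurableT_comp mp (measurable_coord n)) measurableT [set k] _.
  apply/seteqP; split => w /= => [/infinite_set_natP wk m _|wk].
    by have [n mn pn] := wk m; exists n.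
  by apply/infinite_set_natP => m; have [n] := wk m I; exists n.
(* Minimality of [k] is restated as the failure of finitely many events, which makes parity a
   countable union of measurable sets. *)
rewrite (_ : Parity p = \bigcup_(k in [set k | ~~ odd k])
    ([set w | infinitely_often p w k] `&`
     \bigcap_(j in `I_k) ~` [set w | infinitely_often p w j])).
  apply: bigcup_measurable => k _; apply: measurableI => //.
  by apply: bigcap_measurableType => j _; exact: measurableC.
apply/seteqP; split => w.
  move=> [k [wk kmin ek]]; exists k => //; split => // j jk /kmin.
  by rewrite leqNgt jk.
move=> [k ek [wk kmin]]; exists k; split => // j wj.
by rewrite leqNgt; apply/negP => /kmin.
Qed.

Theorem theorem5p6 (R : realType) (disp : measure_display)
  (S : measurableType disp) (F : R.-pker S ~> S)
  (d : nat) (p : S -> nat) (hp : priority_function d p)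
  (hr : exists r : S -> d.-tuple R, PMSM F p r)
  (x0 : S) (P : probability (trajectory S) R)
  (hP : is_trajectory_measure F x0 P) :
  P (Parity p) = 1.
Proof.
have [r hrr] := hr.
have mParity := measurable_Parity (proj1 hp).
suff : P (~` Parity p) = 0.
  by rewrite probability_setC// => /eqP; rewrite sube_eq// add0e => /eqP.
apply: measure_negligible; first exact: measurableC.
(* The union is over all natural levels; those from [d] on are constantly 0 and satisfy the same
   hypotheses. Finiteness holds because the components are real-valued. *)
have := negligible_bigcup (fun l => drift_negligible hP
  (measurable_component l (pmsm_measurable hrr))
  (component_ge0 (pmsm_ge0 hrr) l) (fun x => ltry _)).
move=> negl; apply: negligibleS negl => w wP.
by have [l ?] := not_Parity_drift hp hrr wP; exists l.
Qed.
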